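(* Let $K/\mathbb{Q}$ be a number field and let $\mathcal{A}=\{a_1+I_1,\dots,a_n+I_n\}$ be a finite collection of congruence classes with $a_i\in\mathcal{O}_K$ and $I_i$ distinguishable ideals of $\mathcal{O}_K$, ordered so that $\mathrm{N}(I_1)\le\cdots\le\mathrm{N}(I_n)$. Let $\delta_1,\dots,\delta_J\in[0,1/2]$ and let $M_j^{(1)},M_j^{(2)}$ be as in the context. If \[ \sum_{j=1}^J\min\left\{M_j^{(1)},\frac{M_j^{(2)}}{4\delta_j(1-\delta_j)}\right\}<1, \] then $\mathcal{A}$ does not cover $\mathcal{O}_K$, i.e. $\bigcup_{i=1}^n(a_i+I_i)\ne\mathcal{O}_K$.
   Context: $\mathrm{N}(I)=[\mathcal{O}_K:I]$ is the norm of a nonzero ideal. An ideal $I$ is distinguishable if among its prime ideal factors there is a unique one of largest norm; this prime is denoted $P_{\min}(I)$. Setup: $Q=I_1\cap\cdots\cap I_n$ with prime factorization $Q=\prod_{i=1}^J\mathfrak{p}_i^{\nu_i}$ (distinct primes, $\nu_i\ge1$) ordered so that $\mathrm{N}(\mathfrak{p}_1)\le\cdots\le\mathrm{N}(\mathfrak{p}_J)$; $Q_j=\prod_{i=1}^j\mathfrak{p}_i^{\nu_i}$ ($Q_0=\mathcal{O}_K$); $S=\mathcal{O}_K/Q$ and $\pi_j:S\to\mathcal{O}_K/Q_j$ the natural projections. For $1\le j\le J$, $\mathcal{B}_j=\bigcup_{1\le i\le n,\ P_{\min}(I_i)=\mathfrak{p}_j}\{a+Q: a\equiv a_i \bmod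 I_i\}\subseteq S$. Let $\mathbb{P}_0$ be the uniform probability measure on $S$ and recursively, for $1\le j\le J$ and $x\in S$: $F_{j-1}(x)=\{x'\in S:\pi_{j-1}(x')=\pi_{j-1}(x)\}$, $\alpha_j(x)=|F_{j-1}(x)\cap\mathcal{B}_j|/|F_{j-1}(x)|$, and $\mathbb{P}_j(x)=\mathbb{P}_{j-1}(x)\cdot\frac{1_{x\notin\mathcal{B}_j}}{1-\alpha_j(x)}$ if $\alpha_j(x)<\delta_j$, $\mathbb{P}_j(x)=\mathbb{P}_{j-1}(x)\cdot\frac{\alpha_j(x)-1_{x\in\mathcal{B}_j}\delta_j}{\alpha_j(x)(1-\delta_j)}$ if $\alpha_j(x)\ge\delta_j$ (the factor taken to be $1$ if $\alpha_j(x)=0$). Set $\mathbb{E}_j[f]=\sum_{x\in S}f(x)\mathbb{P}_j(x)$, $M_j^{(1)}=\mathbb{E}_{j-1}[\alpha_j]$, $M_j^{(2)}=\mathbb{E}_{j-1}[\alpha_j^2]$. When $\delta_j=0$, the ratio $M_j^{(2)}/(4\delta_j(1-\delta_j))$ is read as $+\infty$. *)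

(* Defs.v *)
From HB Require Import structures.
From mathcomp Require Import all_boot all_order all_algebra all_field.
From Stdlib Require Import ClassicalEpsilon.
Set Implicit Arguments. Unset Strict Implicit. Unset Printing Implicit Defensive.
Import Order.TTheory GRing.Theory Num.Theory.
Local Open Scope ring_scope.

Section Ideals.
Variable K : fieldExtType rat.

Definition OK (x : K) : Prop := integralOver (fun z : int => z%:~R : K) x.

Definition is_ideal (I : K -> Prop) : Prop :=
  (forall x, I x -> OK x) /\ I 0 /\
  (forall x y, I x -> I y -> I (x + y)) /\
  (forall r x, OK r -> I x -> I (r * x)).

Definition nonzero_ideal (I : K -> Prop) : Prop :=
  is_ideal I /\ exists x, I x /\ x != 0.

Definition ideq (I J : K -> Prop) : Prop := forall x, I x <-> J x.

Definition iprod (I J : K -> Prop) : K -> Prop := fun x =>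
  exists s : seq (K * K), (forall q, q \in s -> I q.1 /\ J q.2) /\
                          x = \sum_(q <- s) q.1 * q.2.

Definition ipow (I : K -> Prop) (m : nat) : K -> Prop := iter m (iprod I) OK.

Definition is_index (I : K -> Prop) (m : nat) : Prop :=
  exists s : seq K, size s = m /\ (forall y, y \in s -> OK y) /\
    (forall x, OK x -> exists2 y, y \in s & I (x - y)) /\
    (forall i j, (i < m)%N -> (j < m)%N -> I (nth 0 s i - nth 0 s j) -> i = j).

Definition norm (I : K -> Prop) : nat :=
  epsilon (inhabits 0%N) (is_index I).

Definition prime_ideal (P : K -> Prop) : Prop :=
  nonzero_ideal P /\ ~ P 1 /\
  (forall x y, OK x -> OK y -> P (x * y) -> P x \/ P y).

Definition prime_factor (P I : K -> Prop) : Prop :=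
  prime_ideal P /\ exists2 J, is_ideal J & ideq I (iprod P J).

Definition is_Pmin (I P : K -> Prop) : Prop :=
  prime_factor P I /\
  forall q, prime_factor q I -> ~ ideq q P -> (norm q < norm P)%N.

Definition distinguishable (I : K -> Prop) : Prop := exists P, is_Pmin I P.

End Ideals.

Definition ind {R : numDomainType} (P : Prop) : R :=
  if excluded_middle_informative P then 1 else 0.

(* The construction. Indices are 0-based: the paper's step j corresponds to k = j-1.
   S = O_K/Q is represented by a complete residue system reps. *)
Section Construction.
Variables (K : fieldExtType rat) (R : realFieldType).
Variables (n : nat) (a : nat -> K) (I : nat -> K -> Prop).
Variables (J : nat) (p : nat -> K -> Prop) (nu : nat -> nat) (delta : nat -> R).
Variable reps : seq K.

Definition Qpart (k : nat) : K -> Prop :=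
  foldr (fun i acc => iprod (ipow (p i) (nu i)) acc) (@OK K) (iota 0 k).

Definition inB (k : nat) (x : K) : Prop :=
  exists i, (i < n)%N /\ is_Pmin (I i) (p k) /\ I i (x - a i).

(* alpha_{k+1}(x), with F_k(x) = {y : y = x mod Q_k} *)
Definition alpha (k : nat) (x : K) : R :=
  (\sum_(y <- reps) ind (Qpart k (y - x) /\ inB k y)) /
  (\sum_(y <- reps) ind (Qpart k (y - x))).

Definition factor (k : nat) (x : K) : R :=
  let al := alpha k x in
  if al == 0 then 1
  else if al < delta k then ind (~ inB k x) / (1 - al)
  else (al - ind (inB k x) * delta k) / (al * (1 - delta k)).

Fixpoint prob (k : nat) (x : K) : R :=
  match k with
  | 0 => 1 / (size reps)%:R
  | k'.+1 => prob k' x * factor k' x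
  end.

(* M1 k = M_{k+1}^{(1)} = E_k[alpha_{k+1}], M2 k = E_k[alpha_{k+1}^2] *)
Definition M1 (k : nat) : R := \sum_(x <- reps) alpha k x * prob k x.
Definition M2 (k : nat) : R := \sum_(x <- reps) alpha k x ^+ 2 * prob k x.

Definition term (k : nat) : R :=
  if delta k == 0 then M1 k
  else Num.min (M1 k) (M2 k / (4 * delta k * (1 - delta k))).

End Construction.

(* Main.v *)
(** The measures [prob k] are built so that conditioning on a residue class
    mod [Q_k] is not affected by step [k]: on each such class the factor is an
    affine function of the indicator of [B_k] with mean 1.  Hence the total mass
    stays 1 and, [B_k] being a union of classes mod [Q_(k+1)], its mass is frozen
    after step [k].  That mass is the mean of [max (0, (alpha - d) / (1 - d))],
    which is at most [alpha] and at most [alpha^2 / (4 d (1 - d))].  If the sum of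
    these bounds is below 1, the last measure charges a point outside every
    [B_k], and each class [a_i + I_i] is part of some [B_k].

    The arithmetic input is that [P_min(I) = p_k] implies [Q_(k+1) <= I]: a prime
    [p_j] with [j > k] is too large to divide [I], hence, as [O_K] is a Dedekind
    domain, does not contain [I] and is coprime to it.  A prime [p] containing [I]
    divides it for the following reason: integrality of the trace makes every
    ideal a finitely generated abelian group, so [O_K / N] is finite and a
    multiplier of a nonzero ideal is integral; a maximal colon ideal [(N : x)]
    inside [p], for an integer [N] of [p], equals [p], and multiplication by
    [x / N] then shows that [p] is invertible. *)
Require Import Defs.
From HB Require Import structures.
From mathcomp Require Import all_boot all_order all_algebra all_field.
From mathcomp Require Import ring lra zify.
From Stdlib Require Import Classical ClassicalEpsilon FunctionalExtensionality PropExtensionality.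
Import Order.TTheory GRing.Theory Num.Theory.
Local Open Scope ring_scope.
Set Implicit Arguments.
Unset Strict Implicit.
Unset Printing Implicit Defensive.

Lemma nat_min (P : nat -> Prop) :
  (exists m, P m) -> exists m, P m /\ forall k, P k -> (m <= k)%N.
Proof.
case=> m; elim/ltn_ind: m => m IH Pm.
case: (classic (exists2 k, (k < m)%N & P k)) => [[k km Pk]|h]; first exact: IH Pk.
by exists m; split=> // k Pk; rewrite leqNgt; apply/negP => km; apply: h; exists k.
Qed.

(** * Algebraic integers of [K]: closure properties and an eigenvalue criterion *)

Section RingOfIntegers.
Variable K : fieldExtType rat.
Implicit Types (x y : K) (G : K -> Prop).

Lemma OK_int (z : int) : OK (z%:~R : K).
Proof. exact: (integral_id (intmul (1 : K))). Qed.

Lemma OK_add x y : OK x -> OK y -> OK (x + y).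
Proof. exact: (@integral_add int K (intmul (1 : K))). Qed.

Lemma OK_mul x y : OK x -> OK y -> OK (x * y).
Proof. exact: (@integral_mul int K (intmul (1 : K))). Qed.

Lemma OK_opp x : OK x -> OK (- x).
Proof. exact: (@integral_opp int K (intmul (1 : K))). Qed.

Lemma OK_sub x y : OK x -> OK y -> OK (x - y).
Proof. by move=> hx hy; apply: OK_add => //; apply: OK_opp. Qed.

Lemma OK_0 : OK (0 : K). Proof. exact: (OK_int 0). Qed.
Lemma OK_1 : OK (1 : K). Proof. exact: (OK_int 1). Qed.

Lemma OK_exp x m : OK x -> OK (x ^+ m).
Proof.
by move=> hx; elim: m => [|m IH]; rewrite ?exprS; [apply: OK_1|apply: OK_mul].
Qed.

Lemma OK_sum (T : eqType) (s : seq T) (F : T -> K) :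
  (forall i, i \in s -> OK (F i)) -> OK (\sum_(i <- s) F i).
Proof.
move=> h; rewrite big_seq; apply: big_ind => //; first exact: OK_0.
exact: OK_add.
Qed.

(** The nonzero row [g] is an eigenvector of [B^T] for [y], so [y] is a root of a characteristic
    polynomial, which is monic with integer coefficients. *)
Lemma OK_eigen m (g : 'I_m -> K) (B : 'M[int]_m) y :
  (exists i, g i != 0) ->
  (forall i, y * g i = \sum_j g j *~ B i j) -> OK y.
Proof.
move=> [i0 gi0] hB.
exists (char_poly B^T); first exact: char_poly_monic.
rewrite (_ : map_poly _ _ = char_poly (map_mx (intmul (1 : K)) B^T)); last first.
  by rewrite -map_char_poly.
rewrite -eigenvalue_root_char; apply/eigenvalueP.
exists (\row_j g j); last first.
  by apply: contra_neq gi0 => /rowP/(_ i0); rewrite !mxE.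
apply/rowP => i; rewrite !mxE hB; apply: eq_bigr => j _.
by rewrite !mxE mulrzr.
Qed.

(** * Multiplication matrices and the field trace *)

Local Notation n := (\dim {: K}).
Local Notation e := (vbasis {: K}).

Definition mulmat x : 'M[rat]_n := \matrix_(i, j) coord e j (x * e`_i).

Lemma mulmatP x (i : 'I_n) : x * e`_i = \sum_j mulmat x i j *: e`_j.
Proof.
rewrite {1}(coord_vbasis (memvf (x * e`_i))).
by apply: eq_bigr => j _; rewrite mxE.
Qed.

Lemma mulmat_mul x y : mulmat (x * y) = mulmat x *m mulmat y.
Proof.
apply/matrixP => i j; rewrite !mxE.
rewrite (mulrC x) -mulrA mulmatP mulr_sumr linear_sum /=.
by apply: eq_bigr => k _; rewrite -scalerAr linearZ /= !mxE.
Qed.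

Lemma mulmat_add x y : mulmat (x + y) = mulmat x + mulmat y.
Proof. by apply/matrixP => i j; rewrite !mxE mulrDl linearD. Qed.

Lemma mulmatZ (q : rat) x : mulmat (q *: x) = q *: mulmat x.
Proof. by apply/matrixP => i j; rewrite !mxE -scalerAl linearZ. Qed.

Lemma mulmat0 : mulmat 0 = 0.
Proof. by apply/matrixP => i j; rewrite !mxE mul0r linear0. Qed.

Lemma mulmat1 : mulmat 1 = 1%:M.
Proof.
apply/matrixP => i j; rewrite !mxE mul1r coord_free //.
exact: basis_free (vbasisP _).
Qed.

Definition ftrace x : rat := \tr (mulmat x).

Lemma ftrace_add x y : ftrace (x + y) = ftrace x + ftrace y.
Proof. by rewrite /ftrace mulmat_add linearD. Qed.

Lemma ftraceZ (q : rat) x : ftrace (q *: x) = q * ftrace x.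
Proof. by rewrite /ftrace mulmatZ linearZ. Qed.

Lemma dimK_gt0 : (0 < n)%N.
Proof. by rewrite (leq_trans _ (dimvS (sub1v {: K}%AS))) // dimv1. Qed.

Lemma ftrace1 : ftrace 1 != 0.
Proof. by rewrite /ftrace mulmat1 mxtrace1 pnatr_eq0 -lt0n dimK_gt0. Qed.

(** [mulmat] is multiplicative and additive, so a Horner induction on [P] applies. When [P] kills
    [x], the eigenvalue [l] must be a root of [P]. *)
Lemma eigen_mulmat_sum (v : 'rV[algC]_n) (l : algC) (P : {poly int}) x :
  v *m map_mx ratr (mulmat x) = l *: v ->
  v *m map_mx ratr (mulmat (map_poly (fun z : int => z%:~R) P).[x]) =
  (map_poly intr P).[l] *: v.
Proof.
move=> hv; elim/poly_ind: P => [|P c IH].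
  by rewrite !rmorph0 !horner0 mulmat0 map_mx0 mulmx0 scale0r.
have E (S : nzRingType) (u : S) : map_poly (fun z : int => z%:~R) (P * 'X + c%:P) =
    map_poly (fun z : int => z%:~R : S) P * 'X + (c%:~R)%:P.
  by rewrite rmorphD rmorphM /= map_polyX map_polyC.
rewrite !E // !hornerE mulmat_add mulmat_mul map_mxD map_mxM mulmxDr mulmxA IH.
rewrite -scalemxAl hv scalerA scalerDl; congr (_ + _).
rewrite -[c%:~R]scaler_int mulmatZ mulmat1.
by rewrite map_mxZ map_mx1 -scalemxAr mulmx1 /= ratr_int.
Qed.

(** The complex eigenvalues of [mulmat x] are roots of the monic polynomial killing [x], hence
    algebraic integers. Their sum, the trace, is rational and an algebraic integer, hence an
    integer. *)
Lemma ftrace_int x : OK x -> exists z : int, ftrace x = z%:~R.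
Proof.
case=> P Pmon Px.
set A := map_mx (ratr : rat -> algC) (mulmat x).
have n_gt0 := dimK_gt0.
have [r Er] := closed_field_poly_normal (char_poly A).
rewrite (monicP (char_poly_monic A)) scale1r in Er.
have hr l : l \in r -> l \in Aint.
  move=> lr; have : root (char_poly A) l by rewrite Er root_prod_XsubC.
  rewrite -eigenvalue_root_char => /eigenvalueP [v hv v0].
  have := eigen_mulmat_sum P hv; rewrite (eqP Px) mulmat0 map_mx0 mulmx0.
  move/esym/eqP; rewrite scaler_eq0 (negPf v0) orbF => Pl.
  apply: (@root_monic_Aint (map_poly intr P) l) => //.
    exact: monic_map.
  by apply/polyOverP => i; rewrite coef_map /= intr_int.
have : (ratr (ftrace x) : algC) \in Aint.
  have -> : ratr (ftrace x) = \sum_(l <- r) l.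
    have sz : size r = n.
      by have := size_char_poly A; rewrite Er size_prod_XsubC => -[].
    rewrite -[RHS]opprK -coefPn_prod_XsubC; last by rewrite sz -lt0n.
    rewrite sz -Er char_poly_trace // opprK /ftrace.
    by rewrite trace_map_mx.
  by rewrite big_seq rpred_sum // => l lr; exact: hr.
move/Cint_rat_Aint => h.
have /intrP [z hz] : (ratr (ftrace x) : algC) \is a Num.int.
  by apply: h; apply: Crat_rat.
exists z; apply: (fmorph_inj (ratr : {rmorphism rat -> algC})).
by rewrite /= hz ratr_int.
Qed.

(** Take for [d] the product of all denominators in [mulmat x]: then [d * x] acts on the basis by an
    integer matrix. *)
Lemma OK_scale x : exists d : int, d != 0 /\ OK (d%:~R * x).
Proof.
pose d : int := \prod_(ij : 'I_n * 'I_n) denq (mulmat x ij.1 ij.2).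
have d0 : d != 0 by apply/prodf_neq0 => ij _; rewrite denq_neq0.
exists d; split=> //.
have hB (i j : 'I_n) : exists z : int, d%:~R * mulmat x i j = z%:~R.
  rewrite /d (bigD1 (i, j)) //= rmorphM /= mulrAC [X in X * _]mulrC -numqE.
  by rewrite -rmorphM /=; eexists.
pose B : 'M[int]_n := \matrix_(i, j) numq (d%:~R * mulmat x i j).
apply: (@OK_eigen n (fun i => e`_i) B).
  exists (Ordinal dimK_gt0) => /=.
  by apply: (basis_not0 (vbasisP {: K})); rewrite mem_nth // size_tuple dimK_gt0.
move=> i; rewrite -mulrA mulmatP mulr_sumr; apply: eq_bigr => j _.
have [z hz] := hB i j.
rewrite [B i j]mxE hz numq_int -[RHS]scaler_int -hz.
by rewrite -[d%:~R in LHS]scaler_int mulr_algl scalerA.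
Qed.

(** * Finite generation of additive groups of algebraic integers *)

Definition int_span (s : seq K) x : Prop :=
  exists z : nat -> int, x = \sum_(i < size s) s`_i *~ z i.

(** The [f k] embed [G] into a lattice of rank [m]. Induction on [m]: generators of the kernel of
    the last coordinate, together with one element where that coordinate takes its least positive
    value, generate [G]. *)
Lemma subgroup_fg m (f : nat -> K -> rat) G :
  (forall k x y, f k (x - y) = f k x - f k y) ->
  G 0 -> (forall x y, G x -> G y -> G (x - y)) ->
  (forall k x, (k < m)%N -> G x -> exists z : int, f k x = z%:~R) ->
  (forall x, G x -> (forall k, (k < m)%N -> f k x = 0) -> x = 0) ->
  exists s, (forall y, y \in s -> G y) /\ (forall x, G x -> int_span s x).
Proof.
move=> fB; have fN k x : f k (- x) = - f k x.
  have f0 : f k 0 = 0 by have := fB k 0 0; rewrite !subrr.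
  by rewrite -[- x]sub0r fB f0 sub0r.
have fD k x y : f k (x + y) = f k x + f k y by rewrite -[y]opprK fB !fN.
have fMz k x z : f k (x *~ z) = f k x *~ z.
  have fMn j : f k (x *+ j) = f k x *+ j.
    elim: j => [|j IH]; last by rewrite !mulrS fD IH.
    by rewrite -[x *+ 0](subrr 0) fB subrr.
  case: z => j; first by rewrite -!pmulrn fMn.
  by rewrite NegzE !mulrNz -!pmulrn fN fMn.
elim: m G => [|m IH] G G0 GB fint finj.
  exists [::]; split=> // x Gx; exists (fun=> 0); rewrite big_ord0.
  exact: finj.
have GN x : G x -> G (- x) by move=> Gx; rewrite -[- x]sub0r; apply: GB.
have GD x y : G x -> G y -> G (x + y).
  by move=> Gx Gy; rewrite -[y]opprK; apply: GB; last apply: GN.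
have GM x z : G x -> G (x *~ z).
  move=> Gx; have GMn j : G (x *+ j).
    by elim: j => [|j IHj]; rewrite ?mulrS ?mulr0n //; apply: GD.
  by case: z => j; rewrite ?NegzE ?mulrNz -?pmulrn; [|apply: GN].
pose G' x := G x /\ f m x = 0.
have [s [sG hs]] : exists s, (forall y, y \in s -> G' y) /\
    (forall x, G' x -> int_span s x).
  apply: IH.
  - by split=> //; have := fB m 0 0; rewrite !subrr.
  - by move=> x y [Gx fx] [Gy fy]; split; [apply: GB|rewrite fB fx fy subrr].
  - by move=> k x km [Gx _]; apply: fint => //; apply: ltnW.
  move=> x [Gx fx] h; apply: finj => // k; rewrite ltnS leq_eqVlt.
  by case/orP => [/eqP -> //|]; apply: h.
pose P d := (0 < d)%N /\ exists2 x, G x & f m x = d%:R.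
case: (classic (exists d, P d)) => [/nat_min [d [[d0 [g Gg fg]] dmin]]|hP].
  exists (g :: s); split.
    by move=> y; rewrite inE => /orP [/eqP -> //|/sG []].
  move=> x Gx; have [z hz] := fint m x (ltnSn m) Gx.
  have dz0 : (d%:Z) != 0 by rewrite -lt0n.
  pose x' := x - g *~ (z %/ d)%Z.
  have Gx' : G x' by apply: GB => //; apply: GM.
  have fx' : f m x' = (z %% d)%Z%:~R.
    rewrite fB fMz fg hz /modz rmorphB rmorphM /=; congr (_ - _).
    by rewrite mulrC mulrzr pmulrn.
  (* A nonzero remainder would be a positive value of [f m] on [G] smaller than [d]. *)
  have zd0 : (z %% d)%Z = 0.
    have := modz_ge0 z dz0; have := ltz_mod z dz0.
    move: fx'; case: (z %% d)%Z => // -[|k] // fx' kd _.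
    have : P k.+1 by split=> //; exists x' => //; rewrite fx' pmulrn.
    by move/dmin; move: kd; lia.
  have [c hc] := hs x' (conj Gx' (etrans fx' (congr1 _ zd0))).
  exists (fun i => if i is j.+1 then c j else (z %/ d)%Z).
  by rewrite big_ord_recl /= -hc /x' addrC subrK.
(* Without a positive value, [f m] vanishes on [G], since a negative value changes sign with [x];
   the kernel is then all of [G]. *)
exists s; split=> [y /sG []//|x Gx]; apply: hs; split=> //.
have [z hz] := fint m x (ltnSn m) Gx.
case: z hz => [[|k]|k] hz; rewrite hz //; case: hP.
  by exists k.+1; split=> //; exists x.
by exists k.+1; split=> //; exists (- x); rewrite ?fN ?hz ?NegzE ?mulrNz ?opprK //; apply: GN.
Qed.

(** The integer coordinates are the trace pairings with a basis of [K] scaled into the algebraic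
    integers. *)
Lemma OK_subgroup_fg G :
  (forall x, G x -> OK x) -> G 0 -> (forall x y, G x -> G y -> G (x - y)) ->
  exists s, (forall y, y \in s -> G y) /\ (forall x, G x -> int_span s x).
Proof.
move=> GOK G0 GB.
pose d k := sval (constructive_indefinite_description _ (OK_scale e`_k)).
have dP k : d k != 0 /\ OK ((d k)%:~R * e`_k).
  by rewrite /d; case: constructive_indefinite_description.
apply: (@subgroup_fg n (fun k x => ftrace (x * ((d k)%:~R * e`_k)))) => //.
- move=> k x y; rewrite mulrBl ftrace_add; congr (_ + _).
  by rewrite -scaleN1r ftraceZ mulN1r.
- by move=> k x _ Gx; apply: ftrace_int; apply: OK_mul (GOK _ Gx) (dP k).2.
move=> x Gx h; apply/eqP; apply/negPn/negP => x0.
case/negP: ftrace1; apply/eqP.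
(* Nondegeneracy: expanding [x^-1] in the basis writes the trace of [1 = x * x^-1] as a combination
   of the vanishing pairings, although that trace is the degree of [K]. *)
rewrite -(divff x0) (coord_vbasis (memvf x^-1)) mulr_sumr.
have -> : ftrace (\sum_(i < n) x * (coord e i x^-1 *: e`_i)) =
    \sum_(i < n) ftrace (x * (coord e i x^-1 *: e`_i)).
  apply: (big_morph ftrace ftrace_add).
  by rewrite /ftrace mulmat0 linear0.
rewrite big1 // => i _; rewrite -scalerAr ftraceZ.
have := h i (ltn_ord i).
rewrite -[(d i)%:~R]scaler_int mulr_algl -scalerAr ftraceZ => /eqP.
rewrite mulf_eq0 intr_eq0 (negPf (dP i).1) /= => /eqP ->.
by rewrite mulr0.
Qed.

End RingOfIntegers.

(** * Finite residue rings, and invertibility of nonzero primes *)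

Section Dedekind.
Variable K : fieldExtType rat.
Implicit Types (x y t u : K) (A B I J p : K -> Prop).

Lemma ideal_OK I x : is_ideal I -> I x -> OK x.
Proof. by case=> h _; apply: h. Qed.

Lemma ideal0 I : is_ideal I -> I 0.
Proof. by case=> _ []. Qed.

Lemma idealD I x y : is_ideal I -> I x -> I y -> I (x + y).
Proof. by case=> _ [_ [h _]]; apply: h. Qed.

Lemma idealM I x y : is_ideal I -> OK x -> I y -> I (x * y).
Proof. by case=> _ [_ [_ h]]; apply: h. Qed.

Lemma idealMr I x y : is_ideal I -> OK y -> I x -> I (x * y).
Proof. by rewrite mulrC; apply: idealM. Qed.

Lemma idealN I x : is_ideal I -> I x -> I (- x).
Proof.
by move=> hI Ix; rewrite -mulN1r; apply: idealM => //; apply/OK_opp/OK_1.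
Qed.

Lemma idealB I x y : is_ideal I -> I x -> I y -> I (x - y).
Proof. by move=> hI Ix Iy; apply: idealD => //; apply: idealN. Qed.

Lemma ideal_sum I (T : eqType) (s : seq T) (F : T -> K) : is_ideal I ->
  (forall i, i \in s -> I (F i)) -> I (\sum_(i <- s) F i).
Proof.
move=> hI h; rewrite big_seq; apply: big_ind => //; first exact: ideal0.
by move=> x y; apply: idealD.
Qed.

Lemma prime_isideal p : prime_ideal p -> is_ideal p.
Proof. by case=> [[]]. Qed.

Lemma prime_exp p x m : prime_ideal p -> OK x -> p (x ^+ m) -> p x.
Proof.
move=> [_ [p1 pP]] hx; elim: m => [/p1 //|m IH].
by rewrite exprS => /pP [] //; apply: OK_exp.
Qed.

(** Only finiteness of the quotient is recorded: the list may be redundant and its members need not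
    be algebraic integers. *)
Definition fin_res A : Prop :=
  exists s : seq K, forall x, OK x -> exists2 y, y \in s & A (x - y).

Lemma fin_res_pigeonhole A (v : nat -> K) :
  (forall x y, A x -> A y -> A (x - y)) -> fin_res A -> (forall i, OK (v i)) ->
  exists i j, (i < j)%N /\ A (v i - v j).
Proof.
move=> AB [s hs] hv.
have hs' i : exists y, y \in s /\ A (v i - y).
  by have [y ys Ay] := hs _ (hv i); exists y.
pose r i := sval (constructive_indefinite_description _ (hs' i)).
have rP i : r i \in s /\ A (v i - r i).
  by rewrite /r; case: constructive_indefinite_description.
have rs i := (rP i).1; have rA i := (rP i).2.
have rlt (i : 'I_(size s).+1) : (index (r i) s < size s)%N by rewrite index_mem.
pose h (i : 'I_(size s).+1) := Ordinal (rlt i).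
have : ~~ injectiveb h.
  apply/injectiveP => /leq_card; rewrite !card_ord.
  by rewrite ltnn.
case/injectivePn => i [j ij hij].
have rij : r i = r j.
  have /= hij' := congr1 val hij.
  by rewrite -(nth_index 0 (rs i)) hij' nth_index.
have hh (k l : nat) : r k = r l -> A (v k - v l).
  by move=> kl; have := AB _ _ (rA k) (rA l); rewrite -kl opprB addrA subrK.
by case: (ltngtP i j) => [lt|lt|/val_inj eq];
  [exists i, j; split=> //; apply: hh
  |exists j, i; split=> //; apply: hh
  |rewrite eq eqxx in ij].
Qed.

Lemma natK_neq0 N : (0 < N)%N -> (N%:R : K) != 0.
Proof.
move=> N0; rewrite -[_%:R](@scaler_nat rat) scaler_eq0 pnatr_eq0 oner_eq0 orbF.
by rewrite -lt0n.
Qed.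

(** The predicate is membership in the ideal generated by [N]. Representatives arise by reducing
    modulo [N] the coefficients on a finite set of generators of the additive group. *)
Lemma fin_res_nat N : (0 < N)%N -> fin_res (fun x => OK (x / N%:R)).
Proof.
move=> N0; have [|||s [sO hs]] := @OK_subgroup_fg K (@OK K).
- by [].
- exact: OK_0.
- exact: OK_sub.
exists [seq \sum_(i < size s) s`_i *~ Posz (c i) | c : {ffun 'I_(size s) -> 'I_N}].
move=> x /hs [z ->].
have N0' : N%:Z != 0 by rewrite -lt0n.
have zlt i : (`|(z i %% N)%Z| < N)%N.
  by have := modz_ge0 (z i) N0'; have := ltz_mod (z i) N0'; lia.
pose c := [ffun i : 'I_(size s) => Ordinal (zlt i)].
eexists; first by apply/imageP; exists c.
rewrite -sumrB mulr_suml; apply: OK_sum => i _.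
rewrite ffunE /= gez0_abs ?modz_ge0 // -mulrzBr.
rewrite {1}(divz_eq (z i) N) addrK mulrzA -[_ *~ Posz N]mulrzr -pmulrn.
rewrite mulfK ?natK_neq0 // -mulrzr; apply: OK_mul (OK_int _ _).
by apply: sO; rewrite mem_nth.
Qed.

(** Two powers of [w] agree modulo [N], so [p] contains [w ^+ i * (1 - w ^+ (j - i))]. As [w] is
    outside [p], the second factor lies in [p], and [w ^+ (j - i.+1)] inverts [w]. *)
Lemma prime_maximal p N w : prime_ideal p -> (0 < N)%N -> p N%:R ->
  OK w -> ~ p w -> exists c, OK c /\ p (1 - w * c).
Proof.
move=> hp N0 pN hw pw; have hpI := prime_isideal hp.
have [i [j [ij h]]] : exists i j, (i < j)%N /\ OK ((w ^+ i - w ^+ j) / N%:R).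
  apply: (fin_res_pigeonhole _ (fin_res_nat N0)) => [x y|i].
    by rewrite mulrBl; apply: OK_sub.
  exact: OK_exp.
have /(idealM hpI h) : p N%:R by [].
rewrite divfK ?natK_neq0 // -(subnKC ij) addSnnS exprD -{1}[w ^+ i]mulr1 -mulrBr.
have [_ [_ hP]] := hp; move/(hP _ _ (OK_exp i hw)).
case=> [|/(prime_exp hp hw) //|]; first by apply: OK_sub (OK_1 _) (OK_exp _ hw).
by rewrite exprS => h'; exists (w ^+ (j - i.+1)); split=> //; apply: OK_exp.
Qed.

(* A nonzero ideal is a finitely generated [Z]-module, so [y] is an eigenvalue
   of an integer matrix. *)
Lemma ideal_stable_OK I y :
  nonzero_ideal I -> (forall u, I u -> I (y * u)) -> OK y.
Proof.
move=> [hI [x0 [Ix0 x00]]] hy.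
have [|||s [sI hs]] := @OK_subgroup_fg K I.
- by move=> x; apply: ideal_OK.
- exact: ideal0.
- by move=> x t; apply: idealB.
have hz (i : 'I_(size s)) : exists z : nat -> int,
    y * s`_i = \sum_(j < size s) s`_j *~ z j.
  by apply: hs; apply: hy; apply: sI; rewrite mem_nth.
pose B : 'M[int]_(size s) := \matrix_(i, j)
  sval (constructive_indefinite_description _ (hz i)) j.
apply: (@OK_eigen K (size s) (fun i => s`_i) B).
  apply: NNPP => h; case/negP: x00; have [z ->] := hs _ Ix0.
  rewrite big1 // => i _; case: (eqVneq s`_i 0) => [->|si]; first by rewrite mul0rz.
  by case: h; exists i.
move=> i; under eq_bigr => j _ do rewrite mxE.
by case: constructive_indefinite_description.
Qed.

(** A classical truth value in [bool], so that [count] applies to propositions. *)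
Definition asb (P : Prop) : bool :=
  if excluded_middle_informative P then true else false.

Lemma asbP P : reflect P (asb P).
Proof. by rewrite /asb; case: excluded_middle_informative => h; constructor. Qed.

Lemma count_lt (T : eqType) (a b : pred T) (s : seq T) r :
  (forall z, a z -> b z) -> r \in s -> b r -> ~~ a r -> (count a s < count b s)%N.
Proof.
move=> ab; elim: s => //= x s IH; rewrite inE => /orP [/eqP <- br ar|rs br ar].
  by rewrite br (negPf ar) add0n add1n ltnS sub_count.
rewrite -addnS leq_add //; last exact: IH.
by case h: (a x) => //; rewrite (ab _ h).
Qed.

(* Take [x] with the colon ideal [(N : x)] maximal among those contained in
   [p]; maximality forces [(N : x) = p]. *)
Lemma prime_colon p N : prime_ideal p -> (0 < N)%N -> p N%:R ->
  exists x, [/\ OK x, ~ OK (x / N%:R) & forall u, p u -> OK (u * x / N%:R)].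
Proof.
move=> hp N0 pN; have hpI := prime_isideal hp.
have [_ [p1 pP]] := hp; have N0' := natK_neq0 N0.
pose D t := OK (t / N%:R).
have DM t x : OK t -> D x -> D (t * x) by move=> ht hx; rewrite /D -mulrA; apply: OK_mul.
have DB t x : D t -> D x -> D (t - x) by rewrite /D mulrBl; apply: OK_sub.
(* [good x] says that the colon ideal [(N : x)] lies inside [p]. *)
pose good x := OK x /\ forall t, OK t -> D (t * x) -> p t.
have [s hs] := fin_res_nat N0.
have [x [gx xmax]] : exists x, good x /\ forall x', good x' ->
    (forall t, OK t -> D (t * x) -> D (t * x')) ->
    forall t, OK t -> D (t * x') -> D (t * x).
  (* [cnt x] measures [(N : x)] by its representatives modulo [N]; a strictly larger colon ideal
     contains strictly more of them, so the largest count gives a maximal one. *)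
  pose cnt x := count (fun r => asb (OK r /\ D (r * x))) s.
  have [|k [[x [gx kx]] kmin]] :=
    @nat_min (fun k => exists x, good x /\ (size s - cnt x)%N = k).
    exists (size s - cnt 1%R)%N, 1; split=> //; split; first exact: OK_1.
    by move=> t _; rewrite mulr1 => /(idealM hpI)/(_ pN); rewrite divfK.
  exists x; split=> // x' gx' sub t ht Dt; apply: NNPP => nDt.
  have [r rs Dr] := hs _ ht.
  have Or : OK r.
    have -> : r = t - (t - r) / N%:R * N%:R by rewrite divfK //; ring.
    by apply: OK_sub => //; apply: OK_mul => //; apply: (OK_int _ N).
  have hr z : OK z -> D (t * z) <-> D (r * z).
    move=> hz; have Drz : D (z * (t - r)) by apply: DM.
    split=> h.
      have -> : r * z = t * z - z * (t - r) by ring.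
      exact: DB.
    have -> : t * z = r * z - - (z * (t - r)) by ring.
    by apply: DB => //; rewrite /D mulNr; apply: OK_opp.
  have := kmin _ (ex_intro _ x' (conj gx' erefl)).
  have : (cnt x < cnt x')%N.
    apply: (@count_lt _ _ _ _ r) => //.
    - by move=> y /asbP [Oy Dy]; apply/asbP; split=> //; apply: sub.
    - by apply/asbP; split=> //; apply/hr => //; apply: gx'.1.
    by apply/asbP => -[_ /hr]; apply: contra_not nDt; apply; apply: gx.1.
  have : (cnt x' <= size s)%N by exact: count_size.
  by rewrite -kx; lia.
have [Ox gx2] := gx; exists x; split=> //.
  by move=> Dx; apply: p1; apply: gx2; [apply: OK_1 | rewrite mul1r].
(* For [t] outside the prime [p], [t * x] is again good and [(N : t * x)] contains [(N : x)]; by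
   maximality a factor [t] can be cancelled. *)
have colon t : OK t -> ~ p t -> forall v, OK v -> D (v * (t * x)) -> D (v * x).
  move=> ht pt; apply: xmax.
    split; first exact: OK_mul.
    move=> v hv; rewrite mulrA => /(gx2 _ (OK_mul hv ht)) /(pP _ _ hv ht) [] //.
  by move=> v hv; rewrite mulrCA; apply: DM.
move=> u pu; have Ou := ideal_OK hpI pu.
have [i [j [ij hij]]] : exists i j, (i < j)%N /\ D (u ^+ i - u ^+ j).
  by apply: (fin_res_pigeonhole DB) => [|i]; [exists s|apply: OK_exp].
(* [N] divides [u ^+ i * (1 - u ^+ (j - i))], and the second factor is outside [p] because [u] is
   inside; cancelling it yields such an exponent. *)
have [k [Dk kmin]] : exists k, D (u ^+ k * x) /\
    forall l, D (u ^+ l * x) -> (k <= l)%N.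
  apply: nat_min; exists i; apply: (colon (1 - u ^+ (j - i))).
  - by apply: OK_sub (OK_1 _) (OK_exp _ Ou).
  - move=> h; apply: p1; rewrite -(subrK (u ^+ (j - i)) 1).
    apply: idealD => //; rewrite -(prednK (n := j - i)) ?subn_gt0 // exprS.
    by apply: idealMr => //; apply: OK_exp.
  - exact: OK_exp.
  rewrite mulrA mulrBr mulr1 -exprD subnKC 1?ltnW // mulrC.
  exact: DM.
case: k Dk kmin => [|k] Dk kmin.
  by case: p1; apply: gx2; [apply: OK_1|rewrite expr0 in Dk].
have nDk : ~ D (u ^+ k * x) by move/kmin; rewrite ltnn.
have Ok := OK_exp k Ou.
(* With [k.+1] the least exponent, [u ^+ k * x] is still good, so maximality gives
   [(N : u ^+ k * x) = (N : x)]; the former contains [u]. *)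
apply: (xmax (u ^+ k * x)) => //.
- split; first exact: OK_mul.
  move=> t ht Dt; apply: NNPP => pt; apply: nDk; apply: (colon t) => //.
  by rewrite mulrCA.
- by move=> t ht; rewrite mulrCA; apply: DM.
- by rewrite mulrA -exprS.
Qed.

(** With [y = x / N], the set [y * p] consists of algebraic integers but is not contained in [p], or
    else [y] would be integral by [ideal_stable_OK]. Maximality of [p] then gives [1] in
    [p + y * p]. *)
Lemma prime_invertible p N : prime_ideal p -> (0 < N)%N -> p N%:R ->
  exists y, (forall u, p u -> OK (y * u)) /\
    exists a b, [/\ p a, p b & 1 = a + y * b].
Proof.
move=> hp N0 pN; have hpI := prime_isideal hp.
have [x [Ox nDx hx]] := prime_colon hp N0 pN.
have hy u : p u -> OK (x / N%:R * u) by rewrite mulrC mulrA; apply: hx.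
exists (x / N%:R); split=> //.
have [u pu nu] : exists2 u, p u & ~ p (x / N%:R * u).
  apply: NNPP => h; apply: nDx; apply: (@ideal_stable_OK p); first by case: hp.
  by move=> u pu; apply: NNPP => h'; apply: h; exists u.
have [c [Oc pc]] := prime_maximal hp N0 pN (hy u pu) nu.
exists (1 - x / N%:R * u * c), (u * c); split=> //.
  exact: idealMr.
by rewrite mulrA subrK.
Qed.

(** The cofactor is [I + y * I]: it is integral because [I] lies in [p], and
    [z = a * z + b * (y * z)] puts [I] inside the product. *)
Lemma prime_contains_divides p N I : prime_ideal p -> (0 < N)%N -> p N%:R ->
  is_ideal I -> (forall x, I x -> p x) -> prime_factor p I.
Proof.
move=> hp N0 pN hI Ip; split=> //; have hpI := prime_isideal hp.
have [y [hy [a [b [pa pb E]]]]] := prime_invertible hp N0 pN.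
exists (fun z => exists x1 x2, [/\ I x1, I x2 & z = x1 + y * x2]).
  split; last split; last split.
  - move=> z [x1 [x2 [I1 I2 ->]]]; apply: OK_add; first exact: ideal_OK I1.
    by apply: hy; apply: Ip.
  - by exists 0, 0; rewrite mulr0 addr0; split=> //; apply: ideal0.
  - move=> _ _ [x1 [x2 [I1 I2 ->]]] [x3 [x4 [I3 I4 ->]]].
    exists (x1 + x3), (x2 + x4); split; [exact: idealD|exact: idealD|ring].
  move=> r _ Or [x1 [x2 [I1 I2 ->]]].
  by exists (r * x1), (r * x2); split; [exact: idealM|exact: idealM|ring].
move=> z; split=> [Iz|[s [hs ->]]].
  exists [:: (a, z); (b, y * z)]; split.
    have I0 := ideal0 hI.
    move=> q; rewrite !inE => /orP [] /eqP -> /=; split=> //.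
      by exists z, 0; rewrite mulr0 addr0.
    by exists 0, z; rewrite add0r.
  rewrite !big_cons big_nil /= -[LHS]mul1r E; ring.
apply: ideal_sum => // -[q1 q2] /hs /= [pq [x1 [x2 [I1 I2 ->]]]].
rewrite mulrDr; apply: idealD => //.
  by apply: idealM => //; apply: ideal_OK pq.
by rewrite mulrA [q1 * y]mulrC; apply: idealM => //; apply: hy.
Qed.

End Dedekind.

(** * Products of ideals, comaximality and products of prime powers *)

Section IdealProducts.
Variable K : fieldExtType rat.
Implicit Types (x y t u : K) (A B I J P : K -> Prop).

Lemma OK_ideal : is_ideal (@OK K).
Proof.
split=> //; split; first exact: OK_0.
by split; [apply: OK_add|apply: OK_mul].
Qed.

Lemma iprod_ideal I J : is_ideal I -> is_ideal J -> is_ideal (iprod I J).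
Proof.
move=> hI hJ; split; last split; last split.
- move=> _ [s [hs ->]]; apply: OK_sum => q /hs [Iq Jq].
  by apply: OK_mul; [apply: ideal_OK Iq|apply: ideal_OK Jq].
- by exists [::]; rewrite big_nil.
- move=> _ _ [s [hs ->]] [s' [hs' ->]]; exists (s ++ s'); rewrite big_cat.
  by split=> // q; rewrite mem_cat => /orP [/hs|/hs'].
move=> r _ Or [s [hs ->]]; exists [seq (r * q.1, q.2) | q <- s]; split.
  by move=> _ /mapP [q /hs [Iq Jq] ->]; split=> //; apply: idealM.
by rewrite big_map mulr_sumr; apply: eq_bigr => q _; rewrite mulrA.
Qed.

Lemma ipow_ideal I m : is_ideal I -> is_ideal (ipow I m).
Proof.
by move=> hI; elim: m => [|m IH]; [apply: OK_ideal|apply: iprod_ideal].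
Qed.

Lemma iprod_mem I J x y : I x -> J y -> iprod I J (x * y).
Proof.
move=> Ix Jy; exists [:: (x, y)]; rewrite big_seq1; split=> // q.
by rewrite inE => /eqP ->.
Qed.

Lemma iprod_subl I J x : is_ideal I -> is_ideal J -> iprod I J x -> I x.
Proof.
move=> hI hJ [s [hs ->]]; apply: ideal_sum => // q /hs [Iq Jq].
by apply: idealMr => //; apply: ideal_OK Jq.
Qed.

Lemma iprod_subr I J x : is_ideal I -> is_ideal J -> iprod I J x -> J x.
Proof.
move=> hI hJ [s [hs ->]]; apply: ideal_sum => // q /hs [Iq Jq].
by apply: idealM => //; apply: ideal_OK Iq.
Qed.

Lemma ipow_mem I m x : I x -> ipow I m (x ^+ m).
Proof.
by move=> Ix; elim: m => [|m IH]; rewrite ?exprS; [apply: OK_1|apply: iprod_mem].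
Qed.

Lemma ipow_sub I m x : is_ideal I -> (0 < m)%N -> ipow I m x -> I x.
Proof.
by case: m => // m hI _; apply: iprod_subl => //; apply: ipow_ideal.
Qed.

Definition comax I A : Prop := exists x y, [/\ I x, A y & 1 = x + y].

Lemma comax_OK I : is_ideal I -> comax I (@OK K).
Proof.
by move=> hI; exists 0, 1; rewrite add0r; split; [apply: ideal0|apply: OK_1|].
Qed.

(** In the expansion of [1 = (x + y) * (x' + y')] every term except [y * y'] lies in [I]. *)
Lemma comax_iprod I A B : is_ideal I -> is_ideal A -> is_ideal B ->
  comax I A -> comax I B -> comax I (iprod A B).
Proof.
move=> hI hA hB [x [y [Ix Ay E]]] [x' [y' [Ix' By E']]].
exists (x * (x' + y') + y * x'), (y * y'); split; last 2 first.
- exact: iprod_mem.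
- by rewrite -addrA -mulrDr -mulrDl -E -E' mulr1.
apply: idealD => //; first by rewrite -E' mulr1.
by apply: idealM => //; apply: ideal_OK Ay.
Qed.

Lemma comax_ipow I A m : is_ideal I -> is_ideal A ->
  comax I A -> comax I (ipow A m).
Proof.
move=> hI hA hIA; elim: m => [|m IH]; first exact: comax_OK.
by apply: comax_iprod => //; apply: ipow_ideal.
Qed.

Lemma comax_prime P N I : prime_ideal P -> (0 < N)%N -> P N%:R ->
  is_ideal I -> ~ (forall x, I x -> P x) -> comax I P.
Proof.
move=> hP N0 PN hI nIP.
have [x Ix nPx] : exists2 x, I x & ~ P x.
  apply: NNPP => h; apply: nIP => x Ix; apply: NNPP => nPx; apply: h.
  by exists x.
have [c [Oc Pc]] := prime_maximal hP N0 PN (ideal_OK hI Ix) nPx.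
exists (x * c), (1 - x * c); split=> //; first exact: idealMr.
by rewrite addrC subrK.
Qed.

(** Extensionality turns equality of ideals as sets into an equation, which allows rewriting one
    prime into another inside [is_Pmin]. *)
Lemma ideq_eq A B : ideq A B -> A = B.
Proof.
move=> h; apply: functional_extensionality => x.
exact: propositional_extensionality.
Qed.

Lemma prime_sub_eq P P' N : prime_ideal P -> (0 < N)%N -> P N%:R ->
  prime_ideal P' -> (forall x, P x -> P' x) -> P' = P.
Proof.
move=> hP N0 PN hP' sub; apply: ideq_eq => x; split; last exact: sub.
move=> P'x; apply: NNPP => nPx.
have hI' := prime_isideal hP'.
have [c [Oc /sub Pc]] := prime_maximal hP N0 PN (ideal_OK hI' P'x) nPx.
case: hP' => _ [n1 _]; apply: n1; rewrite -(subrK (x * c) 1).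
by apply: idealD => //; apply: idealMr.
Qed.

Variables (p : nat -> K -> Prop) (nu : nat -> nat).

(** [Qpart] over an arbitrary index list, convertible to it on [iota 0 k], so that the product can
    be split at an index. *)
Definition powprod (l : seq nat) : K -> Prop :=
  foldr (fun i acc => iprod (ipow (p i) (nu i)) acc) (@OK K) l.

Lemma powprod_ideal l :
  (forall i, i \in l -> is_ideal (p i)) -> is_ideal (powprod l).
Proof.
elim: l => [|i l IH] hl; first exact: OK_ideal.
apply: iprod_ideal; first by apply/ipow_ideal/hl; rewrite mem_head.
by apply: IH => j jl; apply: hl; rewrite inE jl orbT.
Qed.

Lemma powprod_sub l i x : (forall i, i \in l -> is_ideal (p i)) ->
  i \in l -> (0 < nu i)%N -> powprod l x -> p i x.
Proof.
elim: l x => // j l IH x hl.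
have hj : is_ideal (ipow (p j) (nu j)) by apply/ipow_ideal/hl; rewrite mem_head.
have hl' k : k \in l -> is_ideal (p k) by move=> kl; apply: hl; rewrite inE kl orbT.
have hP := powprod_ideal hl'.
rewrite inE => /orP [/eqP -> nj /(iprod_subl hj hP)|il ni /(iprod_subr hj hP)].
  by apply: ipow_sub => //; apply: hl; rewrite mem_head.
exact: IH.
Qed.

Lemma powprod_cat_mul l1 l2 x y :
  powprod l1 x -> powprod l2 y -> (forall i, i \in l2 -> is_ideal (p i)) ->
  powprod (l1 ++ l2) (x * y).
Proof.
move=> h1 h2 hl; elim: l1 x h1 => [|i l IH] x h1 /=.
  by apply: idealM h2 => //; apply: powprod_ideal.
case: h1 => s [hs ->]; exists [seq (q.1, q.2 * y) | q <- s]; split.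
  by move=> _ /mapP [q /hs [pq lq] ->]; split=> //; apply: IH.
by rewrite big_map mulr_suml; apply: eq_bigr => q _; rewrite mulrA.
Qed.

Lemma powprod_cat_sub l1 l2 x : (forall i, i \in l1 ++ l2 -> is_ideal (p i)) ->
  powprod (l1 ++ l2) x -> powprod l1 x.
Proof.
elim: l1 x => [|i l IH] x hl /=; first by apply: ideal_OK; apply: powprod_ideal.
case=> s [hs ->]; exists s; split=> // q /hs [pq lq]; split=> //.
by apply: IH lq => j jl; apply: hl; rewrite inE jl orbT.
Qed.

(** Otherwise each [p i] has an element outside [P]; the product of their powers [nu i] lies in
    [powprod l] but not in the prime [P]. *)
Lemma prime_powprod P l : prime_ideal P ->
  (forall i, i \in l -> is_ideal (p i)) -> (forall x, powprod l x -> P x) ->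
  exists2 i, i \in l & forall x, p i x -> P x.
Proof.
move=> hP hl sub; apply: NNPP => h; have [_ [n1 PP]] := hP.
suff [x lx nPx] : exists2 x, powprod l x & ~ P x by apply: nPx; apply: sub.
have {}h i : i \in l -> exists2 x, p i x & ~ P x.
  move=> il; apply: NNPP => h'; apply: h; exists i => // x px.
  by apply: NNPP => nPx; apply: h'; exists x.
elim: l hl h {sub} => [|i l IH] hl h; first by exists 1 => //; apply: OK_1.
have [||y ly nPy] := IH.
- by move=> j jl; apply: hl; rewrite inE jl orbT.
- by move=> j jl; apply: h; rewrite inE jl orbT.
have [x px nPx] := h i (mem_head _ _).
have hi := hl i (mem_head _ _); have Ox := ideal_OK hi px.
exists (x ^+ nu i * y); first by apply: iprod_mem => //; apply: ipow_mem.
have Oy : OK y.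
  by apply: ideal_OK ly; apply: powprod_ideal => j jl; apply: hl; rewrite inE jl orbT.
by case/(PP _ _ (OK_exp _ Ox) Oy) => // /(prime_exp hP Ox).
Qed.

Lemma comax_powprod I l : is_ideal I -> (forall i, i \in l -> is_ideal (p i)) ->
  (forall i, i \in l -> comax I (p i)) -> comax I (powprod l).
Proof.
move=> hI; elim: l => [|i l IH] hl h; first exact: comax_OK.
have hl' k : k \in l -> is_ideal (p k) by move=> kl; apply: hl; rewrite inE kl orbT.
have hi := hl i (mem_head _ _).
apply: comax_iprod => //; first exact: ipow_ideal.
- exact: powprod_ideal.
- by apply: comax_ipow => //; apply: h; rewrite mem_head.
by apply: IH => // k kl; apply: h; rewrite inE kl orbT.
Qed.

(* The primes [p j] with [k < j] have norm at least [norm (p k)], hence do not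
   divide [I] and are coprime to it. *)
Lemma Qpart_sub_Pmin (J N : nat) I k :
  (forall i, (i < J)%N -> prime_ideal (p i)) ->
  (forall i j, (i < J)%N -> (j < J)%N -> i <> j -> ~ ideq (p i) (p j)) ->
  (forall i, (i < J)%N -> (0 < nu i)%N) ->
  (forall i j, (i <= j)%N -> (j < J)%N -> (norm (p i) <= norm (p j))%N) ->
  (0 < N)%N -> Qpart p nu J N%:R ->
  is_ideal I -> (forall x, Qpart p nu J x -> I x) -> (k < J)%N ->
  is_Pmin I (p k) -> forall x, Qpart p nu k.+1 x -> I x.
Proof.
move=> hp hd hnu hn N0 QN hI QI kJ [_ hmin] x Qx.
have EJ : iota 0 J = iota 0 k.+1 ++ iota k.+1 (J - k.+1) by rewrite -iotaD subnKC.
have hpI i : (i < J)%N -> is_ideal (p i) by move=> iJ; apply/prime_isideal/hp.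
have hl i : i \in iota k.+1 (J - k.+1) -> (k < i < J)%N.
  by rewrite mem_iota subnKC.
have hl' i : i \in iota k.+1 (J - k.+1) -> is_ideal (p i).
  by case/hl/andP => _ iJ; apply: hpI.
have [||y [z [Iy Qz E]]] := @comax_powprod I (iota k.+1 (J - k.+1)) hI.
- exact: hl'.
- move=> j /hl /andP [kj jJ].
  have pN : p j N%:R.
    apply: powprod_sub QN; [|by rewrite mem_iota|exact: hnu].
    by move=> i; rewrite mem_iota => iJ; apply: hpI.
  apply: (comax_prime (hp j jJ) N0 pN hI) => sub.
  have := hmin _ (prime_contains_divides (hp j jJ) N0 pN hI sub).
  have nkj : ~ ideq (p j) (p k) by apply: hd => // jk; rewrite jk ltnn in kj.
  by move/(_ nkj); rewrite ltnNge hn // ltnW.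
have Ox : OK x.
  apply: (@ideal_OK _ (powprod (iota 0 k.+1))) => //.
  apply: powprod_ideal => i; rewrite mem_iota add0n => ik.
  by apply: hpI; apply: leq_trans kJ.
(* In [x = x * y + x * z] the first term lies in [I]; [z] supplies the remaining prime powers, so
   the second lies in the full product [Q], hence in [I]. *)
rewrite -[x]mulr1 E mulrDr; apply: idealD => //; first exact: idealM.
apply: QI; have := @powprod_cat_mul (iota 0 k.+1) _ x z Qx Qz hl'.
by rewrite -EJ.
Qed.

End IdealProducts.

(** * Indicators and averaging over equivalence classes *)

Section Averages.
Variables (R : realFieldType) (T : eqType) (s : seq T).

Lemma ind_ge0 (P : Prop) : 0 <= ind P :> R.
Proof. by rewrite /ind; case: excluded_middle_informative. Qed.

Lemma indT (P : Prop) : P -> ind P = 1 :> R.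
Proof. by rewrite /ind; case: excluded_middle_informative. Qed.

Lemma indF (P : Prop) : ~ P -> ind P = 0 :> R.
Proof. by rewrite /ind; case: excluded_middle_informative. Qed.

Lemma ind_and (P Q : Prop) : ind (P /\ Q) = ind P * ind Q :> R.
Proof.
case: (classic P) => hP; last by rewrite (indF hP) indF ?mul0r // => -[].
case: (classic Q) => hQ; last by rewrite (indF hQ) indF ?mulr0 // => -[].
by rewrite !indT // mulr1.
Qed.

Lemma ind_iff (P Q : Prop) : (P <-> Q) -> ind P = ind Q :> R.
Proof.
move=> PQ; case: (classic P) => hP; first by rewrite !indT //; apply/PQ.
by rewrite !indF // => /PQ.
Qed.

Lemma ind_not (P : Prop) : ind (~ P) = 1 - ind P :> R.
Proof.
case: (classic P) => hP; first by rewrite (indT hP) indF ?subrr.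
by rewrite (indF hP) indT ?subr0.
Qed.

(** The tower property of conditional expectation for the partition of [s] by [e]. Both sides equal
    a double sum over equivalent pairs, weighted by the inverse of the class size. *)
Lemma sum_fiber_avg (e : T -> T -> Prop) (h f : T -> R) :
  (forall x, x \in s -> e x x) ->
  (forall x y, x \in s -> y \in s -> e x y -> e y x) ->
  (forall x y z, x \in s -> y \in s -> z \in s -> e x y -> e y z -> e x z) ->
  (forall x y, x \in s -> y \in s -> e x y -> h x = h y) ->
  \sum_(x <- s) h x * f x =
  \sum_(y <- s) h y * ((\sum_(x <- s) ind (e x y) * f x) / \sum_(x <- s) ind (e x y)).
Proof.
move=> er es et hh; pose c y : R := \sum_(x <- s) ind (e x y).
have c0 y : y \in s -> c y != 0.
  move=> ys; rewrite gt_eqF // /c (big_rem y) //= indT; last exact: er.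
  by rewrite ltr_pwDl // sumr_ge0 // => *; apply: ind_ge0.
have cE x y : x \in s -> y \in s -> e x y -> c x = c y.
  move=> xs ys exy; apply: eq_big_seq => z zs; apply: ind_iff.
  by split=> ez; [apply: et ez exy|apply: et ez (es _ _ _ _ exy)].
transitivity (\sum_(y <- s) \sum_(x <- s) ind (e x y) * (h x * f x / c x)); last first.
  apply: eq_big_seq => y ys; rewrite mulr_suml mulr_sumr.
  apply: eq_big_seq => x xs; case: (classic (e x y)) => exy; last first.
    by rewrite indF // !mul0r mulr0.
  by rewrite indT // !mul1r -/(c y) (cE x y) // (hh x y) // mulrA.
rewrite exchange_big; apply: eq_big_seq => x xs; rewrite -mulr_suml.
have -> : \sum_(y <- s) ind (e x y) = c x.
  by apply: eq_big_seq => y ys; apply: ind_iff; split; apply: es.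
by rewrite [RHS]mulrC divfK // c0.
Qed.

End Averages.

(** * The distorted measures, for a decreasing chain of ideals [Q k] and sets [B k] that are unions
    of classes modulo [Q k.+1] *)

Section Distortion.
Variables (K : fieldExtType rat) (R : realFieldType).
Variables (n : nat) (a : nat -> K) (I : nat -> K -> Prop).
Variables (J : nat) (p : nat -> K -> Prop) (nu : nat -> nat) (delta : nat -> R).
Variable reps : seq K.

Local Notation Q := (Qpart p nu).
Local Notation B := (inB n a I p).
Local Notation alpha := (alpha R n a I p nu reps).
Local Notation factor := (factor n a I p nu delta reps).
Local Notation prob := (prob n a I p nu delta reps).

Hypothesis Q_ideal : forall k, (k <= J)%N -> is_ideal (Q k).
Hypothesis Q_sub : forall k x, (k < J)%N -> Q k.+1 x -> Q k x.
Hypothesis B_inv : forall k x y, (k < J)%N ->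
  x \in reps -> y \in reps -> Q k.+1 (x - y) -> B k x -> B k y.
Hypothesis delta_bnd : forall k, (k < J)%N -> 0 <= delta k <= 1 / 2.

Lemma Q_refl k x : (k <= J)%N -> Q k (x - x).
Proof. by move=> kJ; rewrite subrr; apply: ideal0 (Q_ideal kJ). Qed.

Lemma Q_sym k x y : (k <= J)%N -> Q k (x - y) -> Q k (y - x).
Proof. by move=> kJ h; rewrite -opprB; apply: idealN (Q_ideal kJ) h. Qed.

Lemma Q_trans k x y z : (k <= J)%N -> Q k (x - y) -> Q k (y - z) -> Q k (x - z).
Proof.
by move=> kJ h h'; rewrite -(subrK y x) -addrA; apply: idealD (Q_ideal kJ) h h'.
Qed.

Lemma Q_mono k m x : (k <= m)%N -> (m <= J)%N -> Q m x -> Q k x.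
Proof.
move=> /subnKC <-; elim: (m - k)%N => [|d IH]; first by rewrite addn0.
by rewrite addnS => h /(Q_sub h); apply: IH; apply: ltnW.
Qed.

Lemma fiber_gt0 k x : (k <= J)%N -> x \in reps ->
  0 < \sum_(y <- reps) ind (Q k (y - x)) :> R.
Proof.
move=> kJ xr; rewrite (big_rem x) //= indT; last exact: Q_refl.
by rewrite ltr_pwDl // sumr_ge0 // => *; apply: ind_ge0.
Qed.

Lemma alpha_ge0 k x : 0 <= alpha k x.
Proof. by apply: divr_ge0; apply: sumr_ge0 => *; apply: ind_ge0. Qed.

Lemma alpha_le1 k x : (k <= J)%N -> x \in reps -> alpha k x <= 1.
Proof.
move=> kJ xr; rewrite ler_pdivrMr ?fiber_gt0 // mul1r; apply: ler_sum => y _.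
rewrite ind_and ler_piMr ?ind_ge0 // /ind.
by case: excluded_middle_informative.
Qed.

Lemma alpha_inv k x y : (k <= J)%N -> Q k (x - y) -> alpha k x = alpha k y.
Proof.
move=> kJ h; have E z : Q k (z - x) <-> Q k (z - y).
  by split=> h'; apply: Q_trans h' _ => //; apply: Q_sym.
congr (_ / _); apply: eq_bigr => z _; apply: ind_iff; last exact: E.
by split=> -[h1 h2]; split=> //; apply/E.
Qed.

(* On a fiber of [Q k] the factor is an affine function of the indicator of
   [B k]; [4 d (al - d) <= al ^+ 2] gives the second moment bound. *)
Lemma factor_affine k x : (k < J)%N -> x \in reps -> exists u v : R,
  [/\ forall y, Q k (y - x) -> factor k y = u + v * ind (B k y),
      u + v * alpha k x = 1, (0 <= u) && (0 <= u + v),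
      (u + v) * alpha k x <= alpha k x
    & delta k != 0 ->
      (u + v) * alpha k x <= alpha k x ^+ 2 / (4 * delta k * (1 - delta k))].
Proof.
move=> kJ xr; have al0 := alpha_ge0 k x; have al1 := alpha_le1 (ltnW kJ) xr.
have /andP [d0 d2] := delta_bnd kJ.
have E y : Q k (y - x) -> alpha k y = alpha k x by apply: alpha_inv; apply: ltnW.
set al := alpha k x in al0 al1 E *; set d := delta k in d0 d2 *.
have d1 : 0 < 1 - d by lra.
have [al_eq0|al_neq0] := eqVneq al 0.
  exists 1, 0; split.
  - by move=> y /E Ey; rewrite /factor Ey al_eq0 eqxx mul0r addr0.
  - by rewrite mul0r addr0.
  - by rewrite addr0 ler01.
  - by rewrite al_eq0 mulr0.
  - by rewrite al_eq0 mulr0 expr0n /= mul0r.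
have [ald|dal] := ltP al d.
  have al1' : 1 - al != 0 by lra.
  (* Below the threshold all mass on [B k] is erased, so [u + v = 0]. *)
  exists (1 - al)^-1, (- (1 - al)^-1); split.
  - move=> y /E Ey; rewrite /factor Ey (negPf al_neq0) ald ind_not.
    by field.
  - by field.
  - by rewrite subrr lexx andbT invr_ge0; lra.
  - by rewrite subrr mul0r.
  - move=> dn0; rewrite subrr mul0r divr_ge0 ?sqr_ge0 //.
    by rewrite mulr_ge0 //; lra.
have alp : 0 < al by rewrite lt_def al_neq0.
have d1' : 1 - d != 0 by rewrite gt_eqF.
have uv : (1 - d)^-1 + - d / (al * (1 - d)) = (al - d) / (al * (1 - d)).
  by field; rewrite d1' al_neq0.
have uval : (al - d) / (al * (1 - d)) * al = (al - d) / (1 - d).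
  by field; rewrite d1' al_neq0.
(* Above the threshold [u] is the value of the factor off [B k] and [u + v] its value on [B k],
   which leaves [B k] the share [(al - d) / (1 - d)] of the fiber. *)
exists (1 - d)^-1, (- d / (al * (1 - d))); rewrite uv uval; split.
- move=> y /E Ey; rewrite /factor Ey (negPf al_neq0) -/d ltNge dal /=.
  by field; rewrite d1' al_neq0.
- by field; rewrite d1' al_neq0.
- rewrite invr_ge0 ltW //= divr_ge0 ?subr_ge0 // mulr_ge0 //; exact: ltW.
(* The difference [al * (1 - d) - (al - d)] is [d * (1 - al)], nonnegative since [al <= 1]. *)
- rewrite ler_pdivrMr //; nra.
move=> dn0; have dp : 0 < d by rewrite lt_def dn0.
rewrite invfM mulrA ler_pM2r ?invr_gt0 // ler_pdivlMr; last lra.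
by rewrite -subr_ge0 (_ : _ - _ = (al - 2 * d) ^+ 2) ?sqr_ge0 //; ring.
Qed.

Lemma avg_affine k x (f : K -> R) u v : (k <= J)%N -> x \in reps ->
  (forall y, y \in reps -> Q k (y - x) -> f y = u + v * ind (B k y)) ->
  (\sum_(y <- reps) ind (Q k (y - x)) * f y) / (\sum_(y <- reps) ind (Q k (y - x)))
  = u + v * alpha k x.
Proof.
move=> kJ xr hf; rewrite /Defs.alpha.
set c := \sum_(y <- reps) ind (Q k (y - x)).
have c0 : c != 0 by rewrite gt_eqF // fiber_gt0.
rewrite (_ : \sum_(y <- reps) _ * f y =
    u * c + v * \sum_(y <- reps) ind (Q k (y - x) /\ B k y)); first by field.
rewrite !mulr_sumr -big_split; apply: eq_big_seq => y yr /=; rewrite ind_and.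
case: (classic (Q k (y - x))) => h; last by rewrite (indF R h) !(mul0r, mulr0) addr0.
by rewrite hf // (indT R h) !mul1r mulr1.
Qed.

Lemma sum_fiber_Q k (h f : K -> R) : (k <= J)%N ->
  (forall x y, x \in reps -> y \in reps -> Q k (x - y) -> h x = h y) ->
  \sum_(x <- reps) h x * f x =
  \sum_(y <- reps) h y * ((\sum_(x <- reps) ind (Q k (x - y)) * f x) /
                          \sum_(x <- reps) ind (Q k (x - y))).
Proof.
move=> kJ hh; apply: (sum_fiber_avg (e := fun x y => Q k (x - y))) => //.
- by move=> x _; apply: Q_refl.
- by move=> x y _ _; apply: Q_sym.
- by move=> x y z _ _ _; apply: Q_trans.
Qed.

Lemma indB_inv k m x y : (k < m)%N -> (m <= J)%N -> x \in reps -> y \in reps ->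
  Q m (x - y) -> ind (B k x) = ind (B k y) :> R.
Proof.
move=> km mJ xr yr /(Q_mono km mJ) h; have kJ : (k < J)%N by apply: leq_trans mJ.
by apply: ind_iff; split; apply: B_inv => //; apply: Q_sym.
Qed.

(** [prob k] only involves the steps before [k], hence sets [B i] with [i < k], all unions of
    classes modulo [Q k]. *)
Lemma prob_inv k x y : (k <= J)%N -> x \in reps -> y \in reps ->
  Q k (x - y) -> prob k x = prob k y.
Proof.
elim: k => [//|k IH] kJ xr yr h /=; have h' := Q_sub kJ h.
have hB := indB_inv (ltnSn k) kJ xr yr h.
rewrite (IH (ltnW kJ)) // /Defs.factor (alpha_inv (ltnW kJ) h') hB.
by rewrite !ind_not hB.
Qed.

Lemma prob_ge0 k x : (k <= J)%N -> x \in reps -> 0 <= prob k x.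
Proof.
elim: k => [|k IH] kJ xr /=; first by rewrite divr_ge0.
have [u [v [hf _ /andP [u0 uv0] _ _]]] := factor_affine kJ xr.
rewrite mulr_ge0 ?IH 1?ltnW // (hf x); last by apply: Q_refl; apply: ltnW.
case: (classic (B k x)) => h; first by rewrite (indT R h) mulr1.
by rewrite (indF R h) mulr0 addr0.
Qed.

(** [h * prob k] is constant on each fiber of [Q k], where the new factor averages to 1. *)
Lemma expect_step k (h : K -> R) : (k < J)%N ->
  (forall x y, x \in reps -> y \in reps -> Q k (x - y) -> h x = h y) ->
  \sum_(x <- reps) h x * prob k.+1 x = \sum_(x <- reps) h x * prob k x.
Proof.
move=> kJ hh.
rewrite [LHS](_ : _ = \sum_(x <- reps) h x * prob k x * factor k x); last first.
  by apply: eq_bigr => x _; rewrite -mulrA.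
rewrite (@sum_fiber_Q k); [|exact: ltnW|]; last first.
  by move=> x y xr yr e; rewrite (hh x y) // (@prob_inv k x y) // ltnW.
apply: eq_big_seq => x xr.
have [u [v [hf uv1 _ _ _]]] := factor_affine kJ xr.
have E := @avg_affine k x (factor k) u v (ltnW kJ) xr (fun y _ => hf y).
by rewrite E uv1 mulr1.
Qed.

Lemma expect_mono k m (h : K -> R) : (k <= m)%N -> (m <= J)%N ->
  (forall x y, x \in reps -> y \in reps -> Q k (x - y) -> h x = h y) ->
  \sum_(x <- reps) h x * prob m x = \sum_(x <- reps) h x * prob k x.
Proof.
move=> /subnKC <-; elim: (m - k)%N => [|d IH]; first by rewrite addn0.
rewrite addnS => dJ hh; rewrite -(IH (ltnW dJ) hh).
apply: expect_step => // x y xr yr e.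
by apply: hh => //; apply: Q_mono (leq_addr d k) (ltnW dJ) e.
Qed.

Lemma prob_B k : (k < J)%N -> \sum_(x <- reps) ind (B k x) * prob k.+1 x <=
  term n a I p nu delta reps k.
Proof.
move=> kJ; have kJ' := ltnW kJ.
rewrite (_ : \sum_(x <- reps) _ =
    \sum_(x <- reps) prob k x * (factor k x * ind (B k x))); last first.
  by apply: eq_bigr => x _ /=; ring.
rewrite (@sum_fiber_Q k) //; last by move=> *; apply: prob_inv.
(* Both moment bounds at once: [g] will be [alpha], then [alpha ^+ 2 / (4 d (1 - d))]. *)
have H (g : K -> R) : (forall x u v, x \in reps ->
      (forall y, Q k (y - x) -> factor k y = u + v * ind (B k y)) ->
      (u + v) * alpha k x <= alpha k x ->
      (delta k != 0 ->
      (u + v) * alpha k x <= alpha k x ^+ 2 / (4 * delta k * (1 - delta k))) ->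
      (u + v) * alpha k x <= g x) ->
    \sum_(y <- reps) prob k y *
      ((\sum_(x <- reps) ind (Q k (x - y)) * (factor k x * ind (B k x))) /
       \sum_(x <- reps) ind (Q k (x - y))) <= \sum_(x <- reps) g x * prob k x.
  move=> hg; rewrite !big_seq; apply: ler_sum => x xr.
  have [u [v [hf uv1 _ b1 b2]]] := factor_affine kJ xr.
  (* On a fiber [(u + v * ind) * ind = (u + v) * ind], since an indicator is idempotent. *)
  rewrite (@avg_affine k x (fun y => factor k y * ind (B k y)) 0 (u + v)) //; last first.
    move=> y yr hy; rewrite hf //; case: (classic (B k y)) => h.
      by rewrite (indT R h); ring.
    by rewrite (indF R h); ring.
  rewrite add0r mulrC ler_wpM2r ?prob_ge0 //; exact: hg.
have H1 := H (alpha k) (fun _ _ _ _ _ b _ => b).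
rewrite /term; case: eqVneq => [//|dn0].
rewrite le_min H1 /=.
have := H (fun x => alpha k x ^+ 2 / (4 * delta k * (1 - delta k)))
  (fun _ _ _ _ _ _ b => b dn0).
by rewrite /M2 mulr_suml; under [X in _ <= X]eq_bigr => x _ do rewrite mulrAC.
Qed.

Lemma distortion_uncovered : (0 < size reps)%N ->
  \sum_(k < J) term n a I p nu delta reps k < 1 ->
  exists2 x, x \in reps & forall k, (k < J)%N -> ~ B k x.
Proof.
move=> s0 hsum; apply: NNPP => h.
(* If every residue lay in some [B k], the union bound would force the masses of the [B k] to add up
   to at least the total mass 1. *)
have cov x : x \in reps -> 1 <= \sum_(k < J) ind (B k x) :> R.
  move=> xr; apply: NNPP => h'; apply: h; exists x => // k kJ Bk; apply: h'.
  rewrite (bigD1 (Ordinal kJ)) //= indT // ler_wpDr // sumr_ge0 // => *.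
  exact: ind_ge0.
have E1 : \sum_(x <- reps) 1 * prob J x = 1 :> R.
  rewrite (@expect_mono 0) // -mulr_sumr mul1r /=.
  by rewrite big_const_seq count_predT iter_addr_0 -[LHS]mulr_natr divfK // pnatr_eq0 -lt0n.
have : \sum_(x <- reps) 1 * prob J x <=
    \sum_(x <- reps) (\sum_(k < J) ind (B k x)) * prob J x.
  rewrite !big_seq; apply: ler_sum => x xr.
  by apply: ler_wpM2r; [apply: prob_ge0|apply: cov].
rewrite E1; under eq_bigr => x _ do rewrite mulr_suml.
rewrite exchange_big /= => h1.
suff : \sum_(k < J) \sum_(x <- reps) ind (B k x) * prob J x <=
    \sum_(k < J) term n a I p nu delta reps k.
  by move/(le_trans h1); rewrite leNgt hsum.
(* The mass of [B k] under the last measure is already its mass under [prob k.+1]. *)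
apply: ler_sum => k _; rewrite (@expect_mono k.+1) //; first exact: prob_B.
by move=> x y xr yr; apply: indB_inv.
Qed.

End Distortion.

(** * Application to systems of congruences *)

Theorem theorem2p2 (K : fieldExtType rat) (R : realFieldType)
  (n : nat) (a : nat -> K) (I : nat -> K -> Prop)
  (J : nat) (p : nat -> K -> Prop) (nu : nat -> nat) (delta : nat -> R)
  (reps : seq K) :
  (* congruence classes a_i + I_i, i < n *)
  (forall i, (i < n)%N -> OK (a i)) ->
  (forall i, (i < n)%N -> nonzero_ideal (I i)) ->
  (forall i, (i < n)%N -> distinguishable (I i)) ->
  (forall i j, (i <= j)%N -> (j < n)%N -> (norm (I i) <= norm (I j))%N) ->
  (* Q = I_1 cap ... cap I_n = prod_{i<J} p_i^{nu_i}, distinct primes ordered by norm *)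
  (forall i, (i < J)%N -> prime_ideal (p i)) ->
  (forall i j, (i < J)%N -> (j < J)%N -> i <> j -> ~ ideq (p i) (p j)) ->
  (forall i, (i < J)%N -> (1 <= nu i)%N) ->
  (forall i j, (i <= j)%N -> (j < J)%N -> (norm (p i) <= norm (p j))%N) ->
  ideq (fun x => OK x /\ forall i, (i < n)%N -> I i x) (Qpart p nu J) ->
  (* reps: a complete residue system for S = O_K / Q *)
  (forall y, y \in reps -> OK y) ->
  uniq reps ->
  (forall x, OK x -> exists2 y, y \in reps & Qpart p nu J (x - y)) ->
  (forall x y, x \in reps -> y \in reps -> Qpart p nu J (x - y) -> x = y) ->
  (* delta_j in [0, 1/2] *)
  (forall k, (k < J)%N -> 0 <= delta k <= 1 / 2) ->
  \sum_(k < J) term n a I p nu delta reps k < 1 ->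
  exists x, OK x /\ forall i, (i < n)%N -> ~ I i (x - a i).
Proof.
move=> _ hI hdist _ hp hd hnu hn hQ repsO _ hreps _ hdelta hsum.
have hpI i : (i < J)%N -> is_ideal (p i) by move=> iJ; apply/prime_isideal/hp.
have hiota k i : (k <= J)%N -> i \in iota 0 k -> is_ideal (p i).
  by rewrite mem_iota => kJ ik; apply: hpI; apply: leq_trans kJ.
have Qid k : (k <= J)%N -> is_ideal (Qpart p nu k).
  by move=> kJ; apply: (@powprod_ideal K p nu (iota 0 k)) => i; apply: hiota.
have QI i x : (i < n)%N -> Qpart p nu J x -> I i x.
  by move=> hi /hQ [_]; apply.
have hII i : (i < n)%N -> is_ideal (I i) by move=> /hI [].
(* By pigeonhole two natural numbers agree modulo [Q]; their difference is a positive integer in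
   [Q], hence in every [p i], as the lemmas on primes require. *)
have [N N0 QN] : exists2 N : nat, (0 < N)%N & Qpart p nu J N%:R.
  have [|||i [j [ij h]]] :=
    @fin_res_pigeonhole K (Qpart p nu J) (fun i => i%:R).
  - by move=> x y; apply: idealB (Qid J (leqnn J)).
  - by exists reps.
  - by move=> i; apply: (OK_int K i).
  exists (j - i)%N; first by rewrite subn_gt0.
  by rewrite natrB 1?ltnW // -opprB; apply: idealN (Qid J (leqnn J)) h.
have Qsub := Qpart_sub_Pmin hp hd hnu hn N0 QN.
have [||||x xr hx] := @distortion_uncovered K R n a I J p nu delta reps Qid _ _ hdelta.
- move=> k x kJ; rewrite /Qpart -[k.+1]addn1 iotaD => h.
  apply: powprod_cat_sub h => i; rewrite -iotaD addn1; exact: hiota.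
- move=> k x y kJ _ _ Qxy [i [hi [hmin hx]]]; exists i; split=> //; split=> //.
  have -> : y - a i = (x - a i) - (x - y) by ring.
  apply: idealB => //; first exact: hII.
  exact: (Qsub (I i) k (hII i hi) (fun z => @QI i z hi) kJ hmin).
(* The class of [0] has a representative, so [reps] is not empty. *)
- by have [y] := hreps 0 (OK_0 K); case: (reps).
- exact: hsum.
exists x; split; first exact: repsO.
(* The prime [P] of largest norm dividing [I i] contains [I i], hence [Q], hence some [p k]. By
   maximality [P = p k], so [x] in the class of [a i] would lie in [B k]. *)
move=> i hi hxi; have [P hmin] := hdist i hi.
have [[hP [A hA EI]] _] := hmin.
have QP z : Qpart p nu J z -> P z.
  move=> /(QI i z hi) /EI; apply: iprod_subl => //; exact: prime_isideal.
have [||k] := @prime_powprod K p nu P (iota 0 J) hP.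
- by move=> k; apply: hiota.
- exact: QP.
rewrite mem_iota => kJ sub.
have pN : p k N%:R.
  by apply: powprod_sub QN; [move=> j; apply: hiota|rewrite mem_iota|exact: hnu].
have EP := prime_sub_eq (hp k kJ) N0 pN hP sub.
by apply: (hx k kJ); exists i; rewrite -EP.
Qed.
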